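(* Let $a=0.01$ and let $x^*$ be the unique real root of $x^5+x+a=0$. For every real starting point $x_0\neq x^*$, the sequence defined by $$x_{k+1}=-\sqrt[5]{a+x_k}\qquad(k\ge0)$$ does not converge.
   Context: Here $\sqrt[5]{\cdot}$ denotes the real fifth root of a real number, so $(x_k)$ is a sequence of real numbers. *)

(* Defs.v *)
From HB Require Import structures.
From mathcomp Require Import all_boot all_order all_algebra.
From mathcomp Require Import all_classical all_reals all_analysis.

Set Implicit Arguments.
Unset Strict Implicit.
Unset Printing Implicit Defensive.

Import Order.TTheory GRing.Theory Num.Theory.
Import numFieldNormedType.Exports.

Local Open Scope ring_scope.

(* [powR] is the usual power only on nonnegative bases, so the real fifth root
   is extended to negative numbers as an odd function; see [root5_unique]. *)
Definition root5 {R : realType} (x : R) : R := Num.sg x * `|x| `^ 5^-1.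

Lemma sg5_norm (R : realType) (x : R) : Num.sg x ^+ 5 * `|x| = x.
Proof.
rewrite exprS -[4%N]/(2 * 2)%N exprM sqr_sg.
case: (eqVneq x 0) => [->|_]; first by rewrite normr0 mulr0.
by rewrite expr1n mulr1 -numEsg.
Qed.

Lemma root5K (R : realType) (x : R) : root5 x ^+ 5 = x.
Proof.
rewrite /root5 exprMn -(powR_mulrn 5 (powR_ge0 _ _)) -powRrM mulVf ?pnatr_eq0//.
by rewrite powRr1// sg5_norm.
Qed.

Lemma root5_unique (R : realType) (x y : R) : (y == root5 x) = (y ^+ 5 == x).
Proof.
apply/eqP/eqP => [->|yx]; first exact: root5K.
rewrite /root5 -yx sgrX normrX -(powR_mulrn 5 (normr_ge0 y)) -powRrM.
by rewrite mulfV ?pnatr_eq0// powRr1// sg5_norm.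
Qed.

(* Main.v *)
(** The map [x |-> - root5 (a + x)] is the inverse of [g y = - y^5 - a], whose
    fixed point [xstar] lies in [[-1/4, 0]].  Near [xstar] the map [g] does not
    increase distances, so its inverse does not decrease them: an orbit that
    stays close to [xstar] keeps a constant positive distance from it.  Since a
    limit of the orbit has to be [xstar], and [g xstar = xstar] prevents an
    orbit started elsewhere from ever reaching [xstar], there is no limit. *)

Require Import Defs.
From HB Require Import structures.
From mathcomp Require Import all_boot all_order all_algebra.
From mathcomp Require Import all_classical all_reals all_analysis.
From mathcomp Require Import ring lra.

Set Implicit Arguments.
Unset Strict Implicit.
Unset Printing Implicit Defensive.

Import Order.TTheory GRing.Theory Num.Theory.
Import numFieldNormedType.Exports.

Local Open Scope classical_set_scope.
Local Open Scope ring_scope.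

Lemma addX5_inj (R : realFieldType) : injective (fun y : R => y ^+ 5 + y).
Proof.
move=> y z /= yz; apply/eqP; rewrite -subr_eq0; apply/eqP.
(* The second factor is [1] plus [(y^5 - z^5) / (y - z)] written as a sum of
   squares. *)
have : (y - z) * (1 + ((y ^+ 2 + y * z / 2) ^+ 2 + (z ^+ 2 + y * z / 2) ^+ 2
                       + (y * z) ^+ 2 / 2)) = 0.
  have -> : 0 = (y ^+ 5 + y) - (z ^+ 5 + z) by rewrite yz subrr.
  by field.
move/eqP; rewrite mulf_eq0 => /orP[/eqP//|/eqP q0].
have := sqr_ge0 (y ^+ 2 + y * z / 2).
have := sqr_ge0 (z ^+ 2 + y * z / 2).
have := sqr_ge0 (y * z).
by move: q0; lra.
Qed.

(** Intermediate value theorem: the quintic is at most [0] at [- (1 / 4)] because [a <= 1 / 4], and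
    equals [a >= 0] at [0]. *)
Lemma exists_quintic_root (R : rcfType) (a : R) :
  0 <= a <= 1 / 4 -> exists2 y : R, - (1 / 4) <= y <= 0 & y ^+ 5 + y + a = 0.
Proof.
move=> /andP[a0 a1].
have [||y yI] := @poly_ivt R ('X^5 + 'X + a%:P) (- (1 / 4)) 0.
- by lra.
- by rewrite !hornerE /=; apply/andP; split; lra.
by move=> /rootP y0; exists y => //; rewrite -y0 !hornerE.
Qed.

(** The cofactor of [u - v] in [u ^+ 5 - v ^+ 5] is a sum of five monomials of degree 4, each at
    most [1 / 16] in absolute value, so it is bounded by [5 / 16]. *)
Lemma distX5_le (R : realFieldType) (u v : R) :
  `|u| <= 1 / 2 -> `|v| <= 1 / 2 -> `|u ^+ 5 - v ^+ 5| <= `|u - v|.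
Proof.
move=> hu hv; rewrite subrXX normrM ler_piMr//.
have bound (i : 'I_5) : `|u ^+ (5 - i.+1) * v ^+ i| <= 1 / 16.
  have -> : 1 / 16 = (1 / 2) ^+ (5 - i.+1) * (1 / 2) ^+ i :> R.
    have i4 : (5 - i.+1 + i = 4)%N by rewrite subSS subnK// -ltnS.
    by rewrite -exprD i4; lra.
  by rewrite normrM !normrX ler_pM ?exprn_ge0// lerXn2r// ?nnegrE//; lra.
apply: (le_trans (ler_norm_sum _ _ _)).
apply: (le_trans (ler_sum _ (fun i _ => bound i))).
by rewrite sumr_const card_ord -mulr_natr; lra.
Qed.

Lemma cvg_quintic_root (R : realType) (a l : R) (x : nat -> R) :
  (forall k, x k.+1 ^+ 5 + x k + a = 0) -> x @ \oo --> l ->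
  l ^+ 5 + l + a = 0.
Proof.
move=> xE xl.
have xSl : (fun k => x k.+1) @ \oo --> l by rewrite cvg_shiftS.
have : (fun k => x k.+1 ^+ 5 + x k + a) @ \oo --> l ^+ 5 + l + a.
  apply: cvgD; last exact: cvg_cst.
  by apply: cvgD => //; apply: (cvg_comp _ _ xSl (@exprn_continuous R 5 l)).
rewrite (_ : (fun k => _) = fun=> 0); last exact/funext.
by move=> h; apply: (cvg_unique _ h (cvg_cst _)).
Qed.

Theorem mainTheorem6 (R : realType) (a : R) (ha : a = 1 / 100) :
  exists xstar : R,
    unique (fun y : R => y ^+ 5 + y + a = 0) xstar /\
    forall x : nat -> R,
      x 0%N <> xstar ->
      (forall k : nat, x k.+1 = - root5 (a + x k)) ->
      ~ cvgn x.
Proof.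
have [|s /andP[s1 s2] sE] := @exists_quintic_root R a; first by rewrite ha; lra.
have s_uniq y : y ^+ 5 + y + a = 0 -> s = y.
  by move=> yE; apply: addX5_inj; apply: (@addIr _ a); rewrite sE yE.
exists s; split=> // x x0 xS xcvg.
(* Fifth powers turn the recurrence into a polynomial one, so the limit argument needs no continuity
   of [root5]. *)
have xE k : x k.+1 ^+ 5 + x k + a = 0.
  have -> : x k.+1 ^+ 5 = - (a + x k).
    by rewrite xS exprNn root5K -signr_odd expr1 mulN1r.
  by ring.
have xs : x @ \oo --> s by rewrite (s_uniq _ (cvg_quintic_root xE xcvg)).
have x_neq k : x k != s.
  elim: k => [|k IH]; first exact/eqP.
  by apply: contra_neq IH => e; have := xE k; rewrite e; move: sE; lra.
(* Since [s] lies in [[-1/4, 0]], the radius [1 / 4] keeps the tail of the orbit within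
   [[-1/2, 1/2]], where [distX5_le] applies. *)
have [N _ xN] : \forall k \near \oo, `|s - x k| < 1 / 4.
  by move/cvgrPdist_lt : xs; apply; lra.
have dist_le k : (N <= k)%N -> `|s - x k| <= `|s - x k.+1|.
  move=> Nk.
  have -> : s - x k = - (s ^+ 5 - x k.+1 ^+ 5) by move: sE (xE k); lra.
  rewrite normrN; apply: distX5_le; first by rewrite ler_norml; lra.
  have := xN k.+1 (leq_trans Nk (leqnSn k)).
  by rewrite /= ltr_norml ler_norml => /andP[? ?]; lra.
have dist_ge j : `|s - x N| <= `|s - x (N + j)%N|.
  elim: j => [|j IH]; first by rewrite addn0.
  by rewrite addnS (le_trans IH)// dist_le// leq_addr.
have dN : 0 < `|s - x N| by rewrite normr_gt0 subr_eq0 eq_sym x_neq.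
(* Convergence with the distance at [N] as tolerance contradicts [dist_ge] at [N + M], an index past
   both thresholds. *)
have [M _ xM] : \forall k \near \oo, `|s - x k| < `|s - x N|.
  by move/cvgrPdist_lt : xs; apply.
by have := xM (N + M)%N (leq_addl _ _); rewrite /= ltNge dist_ge.
Qed.
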